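(* The group $\mathcal{B}_n$ maps the set of planar words in $\Sigma_{0,1,n}$ to itself: if $w$ is planar and $\phi\in\mathcal{B}_n$, then $w^\phi$ is planar. In particular, if $n\ge1$, every element of $\{t_1^\phi:\phi\in\mathcal{B}_n\}$ is a planar word.
   Context: $\Sigma_{0,1,n}$ is the free group on $t_1,\dots,t_n$, $\overline t_k=t_k^{-1}$, and $z_1:=(t_1\cdots t_n)^{-1}$. Automorphisms act on the right as exponents. $\mathcal{B}_n$ is the group of automorphisms of $\Sigma_{0,1,n}$ fixing $z_1$ and permuting the conjugacy classes $\{[t_1],\dots,[t_n]\}$. Let $A$ be the set of formal symbols $\overline z_1,t_1,\overline t_1,\dots,t_n,\overline t_n,z_1$, totally ordered by $\overline z_1<t_1<\overline t_1<\dots<t_n<\overline t_n<z_1$. For a reduced word $a_1\cdots a_m$, its Whitehead expansion is $(c_1,\dots,c_{2m+2})=(\overline z_1,a_1,\overline a_1,\dots,a_m,\overline a_m,z_1)$. Two $2$-element sets of integers $\{a,b\},\{c,d\}$ are nested if $a,b,c,d$ are distinct and either both or neither of $c,d$ lie strictly between $a$ and $b$. A family of such sets is nested if every two distinct members are nested. A $2M$-tuple $(c_1,\dots,c_{2M})$ of elements of $A$ is planar if some permutation $\pi$ of $\{1,\dots,2M\}$ satisfies three conditions: - $\pi(i)<\pi(j)\Rightarrow c_i\le c_j$; - the family $\{\{\pi(2i-1),\pi(2i)\}\}_{1\le i\le M}$ is nested; - the family $\{\{\pi(2i),\pi(2i+1)\}\}_{1\le i\le M-1}$ is nested. An element $w$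 is a planar word if the Whitehead expansion of its reduced word is planar. *)

(* Defs.v *)
From mathcomp Require Import all_boot all_order all_fingroup.
Set Implicit Arguments. Unset Strict Implicit. Unset Printing Implicit Defensive.

(* Letters of the free group Sigma_{0,1,n} on t_1..t_n: (k, false) is t_{k+1},
   (k, true) is its inverse \bar t_{k+1} (generators indexed from 0).
   Elements of the free group are represented by reduced words. *)
Definition letter (n : nat) := ('I_n * bool)%type.
Definition word (n : nat) := seq (letter n).

Definition linv n (x : letter n) : letter n := (x.1, ~~ x.2).
Definition winv n (w : word n) : word n := rev (map (@linv n) w).

Definition reduced n (w : word n) : bool :=
  sorted (fun x y => y != linv x) w.

Definition reduce n (w : word n) : word n :=
  foldr (fun x acc => match acc with
                      | y :: acc' => if y == linv x then acc' else x :: acc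
                      | [::] => [:: x] end) [::] w.

Definition gen n (k : 'I_n) : word n := [:: (k, false)].

Definition z1 n : word n := winv [seq (k, false) | k <- enum 'I_n].

(* An endomorphism of the free group is given by the images f k of the
   generators t_{k+1};  w^f is the reduced form of the substituted word. *)
Definition img n (f : 'I_n -> word n) (x : letter n) : word n :=
  if x.2 then winv (f x.1) else f x.1.
Definition wact n (f : 'I_n -> word n) (w : word n) : word n :=
  reduce (flatten (map (img f) w)).

Definition is_aut n (f : 'I_n -> word n) : Prop :=
  exists g : 'I_n -> word n,
    forall k, wact g (wact f (gen k)) = gen k /\ wact f (wact g (gen k)) = gen k.

Definition conjugate n (u v : word n) : Prop :=
  exists x : word n, u = reduce (x ++ v ++ winv x).

Definition in_Bn n (f : 'I_n -> word n) : Prop :=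
  [/\ is_aut f, wact f (z1 n) = z1 n &
      exists s : {perm 'I_n}, forall k, conjugate (wact f (gen k)) (gen (s k))].

(* Symbols of A, encoded by nat preserving the order
   \bar z_1 < t_1 < \bar t_1 < ... < t_n < \bar t_n < z_1 :
   \bar z_1 = 0, t_{k+1} = 2k+1, \bar t_{k+1} = 2k+2, z_1 = 2n+1. *)
Definition code n (x : letter n) : nat := (x.1).*2 + (if x.2 then 2 else 1).

Definition whitehead n (w : word n) : seq nat :=
  0 :: flatten [seq [:: code a; code (linv a)] | a <- w] ++ [:: (n.*2).+1].

Definition sbetween (x a b : nat) : bool := (minn a b < x < maxn a b)%N.
Definition nested2 (a b c d : nat) : bool :=
  uniq [:: a; b; c; d] && (sbetween c a b == sbetween d a b).

(* planar 2M-tuple (0-based indices); p is a permutation of {0,...,2M-1} *)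
Definition planar_tuple (c : seq nat) : Prop :=
  exists M : nat, size c = M.*2 /\
  exists p : nat -> nat,
    [/\ forall i, (i < M.*2)%N -> (p i < M.*2)%N,
        {in [pred i | (i < M.*2)%N] &, injective p},
        (forall i j, (i < M.*2)%N -> (j < M.*2)%N -> (p i < p j)%N ->
                     (nth 0 c i <= nth 0 c j)%N),
        (forall i j, (i < M)%N -> (j < M)%N -> i != j ->
           nested2 (p i.*2) (p i.*2.+1) (p j.*2) (p j.*2.+1)) &
        (forall i j, (i.+1 < M)%N -> (j.+1 < M)%N -> i != j ->
           nested2 (p i.*2.+1) (p i.*2.+2) (p j.*2.+1) (p j.*2.+2))].

Definition planar n (w : word n) : Prop := planar_tuple (whitehead (reduce w)).

(* Main.v *)
(** A planar word is a word read off a simple arc in a disc with n punctures, which is cut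
    along n disjoint arcs from the punctures to the boundary: each letter is a crossing with
    a cut, the first nested family consists of the pieces of the arc in the resulting
    polygon, and the second one says that the two copies of each cut are glued along a
    reflection.  Such a diagram makes sense for unreduced words too, and an innermost fold
    (two consecutive inverse letters with nothing in between) can be erased, so every
    word that carries a diagram is planar.  The substitution by a braid generator
    t_i -> t_i t_{i+1} t_i^-1, t_{i+1} -> t_i, or by its inverse, lifts to diagrams without
    any reduction.  Finally, by Artin's argument, an element of B_n is a product of these
    generators: if f(t_k) = x_k^-1 t_{s(k)} x_k and f preserves t_1 ... t_n, then either all
    x_k are trivial, or some central letter is absorbed by a neighbouring conjugator, and a
    generator shortens the total length of the x_k. *)

Require Import Defs.
From mathcomp Require Import all_boot all_order all_fingroup zify.
Set Implicit Arguments. Unset Strict Implicit. Unset Printing Implicit Defensive.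

(** * Free reduction *)

Section FreeGroup.
Variable n : nat.
Implicit Types (u v w : word n) (x y : letter n) (f : 'I_n -> word n).

Lemma linvK : involutive (@linv n).
Proof. by case=> k b; rewrite /linv /= negbK. Qed.

Lemma winv_cat u v : winv (u ++ v) = winv v ++ winv u.
Proof. by rewrite /winv map_cat rev_cat. Qed.

Lemma winv_cons x u : winv (x :: u) = rcons (winv u) (linv x).
Proof. by rewrite /winv /= rev_cons. Qed.

Lemma winv_rcons u x : winv (rcons u x) = linv x :: winv u.
Proof. by rewrite /winv map_rcons rev_rcons. Qed.

Lemma winvK : involutive (@winv n).
Proof. by move=> u; rewrite /winv map_rev revK -map_comp map_id_in // => x _ /=; rewrite linvK. Qed.

Lemma size_winv u : size (winv u) = size u.
Proof. by rewrite size_rev size_map. Qed.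

Lemma reduced_cons x u :
  reduced (x :: u) = (if u is y :: _ then y != linv x else true) && reduced u.
Proof. by case: u. Qed.

Lemma reduced_cat u v :
  reduced (u ++ v) =
  [&& reduced u, reduced v &
      (if v is y :: _ then if u is _ :: _ then y != linv (last y u) else true else true)].
Proof.
elim: u => [|x u IH]; first by case: v => [|y v] //=; rewrite andbT.
rewrite cat_cons !reduced_cons IH; case: u {IH} => [|z u] /=; case: v => [|y v];
  rewrite ?andbT ?andbA //=; first by rewrite andbC.
Qed.

Lemma reduced_winv u : reduced (winv u) = reduced u.
Proof.
rewrite /reduced /winv rev_sorted sorted_map; apply: eq_sorted => x y /=.
by rewrite linvK eq_sym.
Qed.

Lemma reduce_cons x u :
  reduce (x :: u) = match reduce u with
                    | y :: v => if y == linv x then v else x :: y :: v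
                    | [::] => [:: x] end.
Proof. by rewrite /reduce /= -/(reduce u); case: (reduce u). Qed.

Lemma reduced_reduce u : reduced (reduce u).
Proof.
elim: u => [|x u] //; rewrite reduce_cons.
case: (reduce u) => [|y v] // r; case: eqP => [_|/eqP ne]; last by rewrite reduced_cons ne.
by move: r; rewrite reduced_cons => /andP[].
Qed.

Lemma reduce_id u : reduced u -> reduce u = u.
Proof.
elim: u => [|x u IH] //; rewrite reduced_cons reduce_cons => /andP[h /IH ->].
by case: u h {IH} => // y v /negbTE ->.
Qed.

Lemma size_reduceP u : ~~ reduced u -> size (reduce u) < size u.
Proof.
elim: u => [|x u IH] //; rewrite reduced_cons reduce_cons /=.
case: (boolP (reduced u)) => [r|/IH].
  by rewrite andbT (reduce_id r); case: u {IH r} => // y v; rewrite negbK => -> /=; lia.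
by case: (reduce u) => [|y v] //= lt _; case: ifP => _ /=; lia.
Qed.

(** Equality in the free group, stated for unreduced words so that concatenation and substitution
    need no intermediate reduction. *)
Definition weq u v := reduce u = reduce v.

Lemma weq_cons x u v : weq u v -> weq (x :: u) (x :: v).
Proof. by rewrite /weq !reduce_cons => ->. Qed.

Lemma weq_cancel x u : weq (x :: linv x :: u) u.
Proof.
rewrite /weq !reduce_cons; have := reduced_reduce u.
case: (reduce u) => [|y v]; first by rewrite eqxx.
case: eqP => [->|_]; last by rewrite eqxx.
by rewrite linvK; case: v => // z v; rewrite reduced_cons => /andP[/negbTE ->].
Qed.

Lemma weq_catl w u v : weq u v -> weq (w ++ u) (w ++ v).
Proof. by move=> h; elim: w => //= x w; apply: weq_cons. Qed.

Lemma weq_reduce u : weq (reduce u) u.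
Proof. by rewrite /weq reduce_id // reduced_reduce. Qed.

Lemma weq_reduce_cat u v : weq (reduce u ++ v) (u ++ v).
Proof.
elim: u => [|x u IH] //; rewrite reduce_cons.
have := weq_cons x IH; case: (reduce u) => [|y t] //=.
by case: eqP => [->|_] //=; rewrite /weq => <-; rewrite weq_cancel.
Qed.

Lemma weq_cat u u' v v' : weq u u' -> weq v v' -> weq (u ++ v) (u' ++ v').
Proof.
move=> hu hv; rewrite /weq -(weq_reduce_cat u) hu weq_reduce_cat.
exact: weq_catl.
Qed.

Lemma weq_catr w u v : weq u v -> weq (u ++ w) (v ++ w).
Proof. by move=> h; apply: weq_cat. Qed.

Lemma weq_sym u v : weq u v -> weq v u. Proof. by rewrite /weq => ->. Qed.

Lemma weq_trans u v w : weq u v -> weq v w -> weq u w. Proof. by rewrite /weq => ->. Qed.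

Lemma weq_catV u : weq (u ++ winv u) [::].
Proof.
elim: u => [|x u IH] //; rewrite winv_cons -cats1 /= catA.
apply: weq_trans (weq_cancel x [::]); apply: weq_cons.
exact: (weq_catr [:: linv x] IH).
Qed.

Lemma weq_Vcat u : weq (winv u ++ u) [::].
Proof. by have := weq_catV (winv u); rewrite winvK. Qed.

Lemma weq_winv u v : weq u v -> weq (winv u) (winv v).
Proof.
move=> h; apply: (@weq_trans _ (winv u ++ (v ++ winv v))).
  by rewrite -{1}[winv u]cats0; apply: weq_catl; apply: weq_sym; apply: weq_catV.
rewrite catA -[in X in weq _ X](cat0s (winv v)); apply: weq_catr.
by apply: weq_trans (weq_Vcat u); apply: weq_catl; apply: weq_sym.
Qed.

Definition sub f w : word n := flatten (map (img f) w).

Lemma sub_cons f x w : sub f (x :: w) = img f x ++ sub f w. Proof. by []. Qed.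

Lemma sub_cat f u v : sub f (u ++ v) = sub f u ++ sub f v.
Proof. by rewrite /sub map_cat flatten_cat. Qed.

Lemma img_linv f x : img f (linv x) = winv (img f x).
Proof. by case: x => k [] //=; rewrite /img /= winvK. Qed.

Lemma sub_winv f w : sub f (winv w) = winv (sub f w).
Proof.
elim: w => // x w IH; rewrite winv_cons -cats1 sub_cat IH sub_cons winv_cat.
by rewrite /sub /= cats0 img_linv.
Qed.

Lemma sub_of_gen f k : sub f (gen k) = f k.
Proof. by rewrite /sub /= cats0. Qed.

(** A cancelling pair is sent to a word followed by its inverse, so substitution respects equality
    in the free group. *)
Lemma weq_sub f u v : weq u v -> weq (sub f u) (sub f v).
Proof.
suff red w : weq (sub f (reduce w)) (sub f w).
  by move=> h; rewrite /weq -(red u) h; apply: red.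
elim: w => // x w IH; rewrite reduce_cons; move: IH.
case: (reduce w) => [|y v'] IH; first exact: (weq_catl (img f x) IH).
case: eqP => [yE|_]; last exact: (weq_catl (img f x) IH).
apply: weq_trans (weq_catl (img f x) IH); rewrite sub_cons yE img_linv catA.
by apply: (@weq_catr _ [::]); apply: weq_sym; apply: weq_catV.
Qed.

Lemma eq_weq_sub f f' w : (forall k, weq (f k) (f' k)) -> weq (sub f w) (sub f' w).
Proof.
move=> h; elim: w => // -[k b] w IH; rewrite !sub_cons; apply: weq_cat => //.
by rewrite /img /=; case: b; [apply: weq_winv; apply: h | apply: h].
Qed.

Lemma sub_sub f f' w : sub f' (sub f w) = sub (fun k => sub f' (f k)) w.
Proof.
elim: w => // -[k b] w IH; rewrite !sub_cons sub_cat IH; congr (_ ++ _).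
by case: b => //; rewrite /img /= sub_winv.
Qed.

Lemma sub_id w : sub (@gen n) w = w.
Proof. by elim: w => // -[k []] w IH; rewrite sub_cons IH. Qed.

End FreeGroup.

(** * Curve diagrams *)

Lemma nested2E a b c d :
  nested2 a b c d =
  [&& a != b, a != c, a != d, b != c, b != d, c != d &
      ((a < c < b) || (b < c < a)) == ((a < d < b) || (b < d < a))].
Proof.
have sb x : sbetween x a b = (a < x < b) || (b < x < a) by rewrite /sbetween; lia.
by rewrite /nested2 !sb /= !inE !negb_or !andbT -!andbA.
Qed.

(** Nestedness depends only on the relative order of the four points, so a diagram may use arbitrary
    naturals as positions. *)
Lemma nested2_mono (r : nat -> nat) a b c d :
  {in [:: a; b; c; d] &, forall x y, (r x < r y) = (x < y)} ->
  nested2 (r a) (r b) (r c) (r d) = nested2 a b c d.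
Proof.
move=> h; have mem x : x \in [:: a; b; c; d] -> forall y, y \in [:: a; b; c; d] ->
  (r x < r y) = (x < y) by move=> hx y hy; apply: h.
have ina : a \in [:: a; b; c; d] by rewrite !inE eqxx.
have inb : b \in [:: a; b; c; d] by rewrite !inE eqxx ?orbT.
have inc : c \in [:: a; b; c; d] by rewrite !inE eqxx ?orbT.
have ind : d \in [:: a; b; c; d] by rewrite !inE eqxx ?orbT.
by rewrite !nested2E !neq_ltn !(mem a, mem b, mem c, mem d).
Qed.

Section Pairwise.
Variables (S T : Type).

Lemma pairwise_flatten (r : rel S) (f : T -> seq S) s :
  all (fun x => pairwise r (f x)) s ->
  pairwise (fun x y => allrel r (f x) (f y)) s ->
  pairwise r (flatten (map f s)).
Proof.
elim: s => //= x s IH /andP[px ps] /andP[ax pr].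
rewrite pairwise_cat px IH // andbT /= {px ps pr IH}.
elim: s ax => [|y s IH] /=; first by rewrite allrel0r.
by case/andP => xy /IH xs; rewrite allrel_catr xy xs.
Qed.

End Pairwise.

Lemma perm_pairwise (T : eqType) (r : rel T) : symmetric r ->
  forall s t : seq T, perm_eq s t -> pairwise r s = pairwise r t.
Proof.
move=> sr s t; move: s t; apply: catCA_perm_subst => s1 s2 s3.
rewrite !pairwise_cat !allrel_catr (allrelC r s1 s2).
have -> : allrel (fun x y => r y x) s2 s1 = allrel r s2 s1.
  by apply: eq_allrel => x y; rewrite sr.
by rewrite -!andbA; do !bool_congr.
Qed.

Lemma nth_interleave_odd (S : Type) (T : Type) (F G : S -> T) (z x y : T) (a0 : S) l i :
  i < size l ->
  nth z (x :: flatten [seq [:: F a; G a] | a <- l] ++ [:: y]) i.*2.+1 = F (nth a0 l i).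
Proof. by elim: l x i => [|a l IH] x [|i] //= lt; rewrite -(IH (G a) i lt). Qed.

Lemma nth_interleave_even (S : Type) (T : Type) (F G : S -> T) (z x y : T) (a0 : S) l i :
  i < size l ->
  nth z (x :: flatten [seq [:: F a; G a] | a <- l] ++ [:: y]) i.*2.+2 = G (nth a0 l i).
Proof. by elim: l x i => [|a l IH] x [|i] //= lt; rewrite -(IH (G a) i lt). Qed.

Lemma nth_interleave_last (S : Type) (T : Type) (F G : S -> T) (z x y : T) l :
  nth z (x :: flatten [seq [:: F a; G a] | a <- l] ++ [:: y]) (size l).*2.+1 = y.
Proof. by elim: l x => [|a l IH] x //=; rewrite -[RHS](IH (G a)). Qed.

Lemma size_interleave (S : Type) (T : Type) (F G : S -> T) (x y : T) l :
  size (x :: flatten [seq [:: F a; G a] | a <- l] ++ [:: y]) = (size l).+1.*2.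
Proof. by elim: l x => [|a l IH] x //=; have /= := IH x; lia. Qed.

Section Diagram.
Variable n : nat.

(* A crossing of the curve with the k-th cut: its letter, and the positions
   [lo] and [hi] of its two copies on the sides t_k and \bar t_k of the polygon
   obtained by cutting the surface. *)
Definition crossing := (letter n * (nat * nat))%type.
Implicit Types (c d : crossing) (D : seq crossing).

Definition lbl c : nat := c.1.1.
Definition lo c := c.2.1.
Definition hi c := c.2.2.
(** Along the curve, the letter $t_k$ arrives on the side $t_k$ and leaves from the side $\bar t_k$;
    an inverse letter does the opposite. *)
Definition ent c := if c.1.2 then hi c else lo c.
Definition ext c := if c.1.2 then lo c else hi c.

(** The two copies of a cut are glued by a reflection, so two crossings of the same cut span
    strictly nested intervals; for different cuts the order of the labels decides. *)
Definition compat c d :=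
  [|| (lbl c < lbl d) && (hi c < lo d), (lbl d < lbl c) && (hi d < lo c) |
      (lbl c == lbl d) &&
      ((lo c < lo d) && (hi d < hi c) || (lo d < lo c) && (hi c < hi d))].

Fixpoint arcs (s : nat) D (e : nat) : seq (nat * nat) :=
  if D is c :: D' then (s, ent c) :: arcs (ext c) D' e else [:: (s, e)].

Definition nest (a b : nat * nat) := nested2 a.1 a.2 b.1 b.2.

Definition diagram s D e :=
  [&& s < e, all (fun c => [&& s < lo c, lo c < hi c & hi c < e]) D,
      pairwise compat D & pairwise nest (arcs s D e)].

Lemma compatC : symmetric compat.
Proof. by move=> c d; rewrite /compat; apply/idP/idP; clear; lia. Qed.

Lemma nestC : symmetric nest.
Proof. by move=> [a b] [c d]; rewrite /nest !nested2E /=; apply/idP/idP; clear; lia. Qed.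

Lemma compat_nested2 c d : compat c d -> lo c < hi c -> lo d < hi d ->
  nested2 (ent c) (ext c) (ent d) (ext d).
Proof.
rewrite nested2E /compat /ent /ext.
move: (lbl c) (lbl d) (lo c) (hi c) (lo d) (hi d) => k k' x y x' y'.
by case: c.1.2; case: d.1.2; clear; lia.
Qed.

Definition points s D e := s :: flatten [seq [:: ent c; ext c] | c <- D] ++ [:: e].

Lemma size_arcs s D e : size (arcs s D e) = (size D).+1.
Proof. by elim: D s => //= c D IH s; rewrite IH. Qed.

Lemma nth_arcs s D e i : i <= size D ->
  nth (0, 0) (arcs s D e) i = (nth 0 (points s D e) i.*2, nth 0 (points s D e) i.*2.+1).
Proof.
elim: D s i => [|c D IH] s [|i] //= le; by rewrite (IH (ext c) i le).
Qed.

(** The required permutation sends an index to the rank of its position among all points of the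
    diagram. *)
Lemma diagram_planar_tuple s D e :
  diagram s D e -> planar_tuple (whitehead (map fst D)).
Proof.
case/and4P=> se bnd cmp nst.
pose Q := (0, s) :: flatten [seq [:: (code c.1, ent c); (code (linv c.1), ext c)] | c <- D]
            ++ [:: ((n.*2).+1, e)].
(* On pairs of a symbol and a position: positions differ, and their order never contradicts that of
   the symbols. *)
pose R (x y : nat * nat) :=
  [&& x.2 != y.2, (x.2 < y.2) ==> (x.1 <= y.1) & (y.2 < x.2) ==> (y.1 <= x.1)].
have RS : symmetric R by move=> [a b] [c d]; rewrite /R /=; apply/idP/idP; clear; lia.
have QR : pairwise R Q.
  have bnd' c : c \in D -> [/\ s < lo c, lo c < hi c, hi c < e & c.1.1 < n].
    by move=> cD; have /and3P[] := allP bnd _ cD; split => //; exact: ltn_ord.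
  rewrite /= pairwise_cat; apply/and3P; split => /=.
  - apply/allP => x; rewrite mem_cat inE => /orP[/flattenP[l /mapP[c cD ->]]|/eqP->].
      have [] := bnd' c cD; rewrite /R /ent /ext.
      by rewrite !inE => h1 h2 h3 h4 /orP[/eqP->|/eqP->] /=; case: (c.1.2); clear -h1 h2 h3; lia.
    by rewrite /R /=; clear -se; lia.
  - apply/allrelP => x y; rewrite inE => /flattenP[l /mapP[c cD ->]] hx /eqP->.
    have [] := bnd' c cD; move: hx; rewrite /R /ent /ext /code /linv.
    by rewrite !inE => /orP[/eqP->|/eqP->] /= h1 h2 h3 h4; case: (c.1.2) => /=;
      clear -h1 h2 h3 h4; lia.
  rewrite andbT; apply: pairwise_flatten.
    apply/allP => c cD /=; have [] := bnd' c cD; rewrite /R /ent /ext /code /linv /= => h1 h2 h3 h4.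
    by case: (c.1.2) => /=; clear -h1 h2 h3 h4; lia.
  apply: (@sub_in_pairwise _ [in D] compat) cmp => [c d cD dD|]; last by apply/allP.
  have [] := bnd' c cD; have [] := bnd' d dD.
  rewrite /allrel /R /ent /ext /code /linv /compat /lbl /= => h1 h2 h3 h4 h5 h6 h7 h8.
  by case: (c.1.2) (d.1.2) => -[] /=; clear -h1 h2 h3 h4 h5 h6 h7 h8; lia.
have Q2 : map snd Q = points s D e.
  rewrite /Q /points /= map_cat /= map_flatten -map_comp.
  by congr (_ :: flatten _ ++ _); apply: eq_map.
have Q1 : map fst Q = whitehead (map fst D).
  rewrite /Q /whitehead /= map_cat /= map_flatten -!map_comp.
  by congr (_ :: flatten _ ++ _); apply: eq_map.
pose P := points s D e; set M := (size D).+1.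
have szQ : size Q = M.*2 by rewrite size_interleave.
have szP : size P = M.*2 by rewrite /P -Q2 size_map.
pose r x := count (fun y => y < x) P.
have rlt x y : x \in P -> x < y -> r x < r y.
  move=> xP xy; rewrite /r (seq.permP (perm_to_rem xP)) (seq.permP (perm_to_rem xP)) /=.
  rewrite ltnn xy add0n add1n ltnS; apply: sub_count => z /=; clear -xy; lia.
have rE : {in P &, forall x y, (r x < r y) = (x < y)}.
  move=> x y xP yP; apply/idP/idP; last exact: rlt.
  by apply: contraTT; rewrite -!leqNgt leq_eqVlt => /orP[/eqP->//|/(rlt _ _ yP)/ltnW].
have nP i : i < M.*2 -> nth 0 P i \in P by move=> lt; rewrite mem_nth ?szP.
have QRn i j : i < M.*2 -> j < M.*2 -> i != j -> R (nth (0, 0) Q i) (nth (0, 0) Q j).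
  move=> iM jM; rewrite neq_ltn => /orP[] lt; last rewrite RS;
    by apply: (pairwiseP (0, 0) QR) => //; rewrite inE szQ.
have nQ i : i < M.*2 -> nth (0, 0) Q i = (nth 0 (whitehead (map fst D)) i, nth 0 P i).
  move=> lt; rewrite /P -Q1 -Q2 !(nth_map (0, 0)) ?szQ //; exact: surjective_pairing.
exists M; split; first by rewrite -Q1 size_map.
exists (fun i => r (nth 0 P i)); split.
- move=> i iM; rewrite -szP -(count_predT P) /r.
  rewrite (seq.permP (perm_to_rem (nP i iM))) [X in _ < X](seq.permP (perm_to_rem (nP i iM))) /=.
  by rewrite ltnn add0n add1n ltnS; apply: sub_count.
- move=> i j; rewrite !inE => iM jM eqr; apply/eqP; apply: contraT => ne.
  have := QRn i j iM jM ne; rewrite !nQ // /R /=.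
  have := rE _ _ (nP i iM) (nP j jM); have := rE _ _ (nP j jM) (nP i iM).
  by move: eqr; clear; lia.
- move=> i j iM jM lt; have [->//|ne] := eqVneq i j.
  have := QRn i j iM jM ne; rewrite !nQ // /R /=; move: lt; rewrite rE ?nP // => ->.
  by case/and3P.
(* The first family consists of the arcs; the second, in the next item, consists of the pairs of
   copies of the crossings. *)
- move=> i j iM jM ne; rewrite nested2_mono.
    have ai : nth (0, 0) (arcs s D e) i = (nth 0 P i.*2, nth 0 P i.*2.+1) by rewrite nth_arcs.
    have aj : nth (0, 0) (arcs s D e) j = (nth 0 P j.*2, nth 0 P j.*2.+1) by rewrite nth_arcs.
    suff : nest (nth (0, 0) (arcs s D e) i) (nth (0, 0) (arcs s D e) j) by rewrite ai aj.
    by move: ne; rewrite neq_ltn => /orP[] lt; last rewrite nestC;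
      apply: (pairwiseP (0, 0) nst) => //; rewrite inE size_arcs.
  have inP x : x \in [:: nth 0 P i.*2; nth 0 P i.*2.+1; nth 0 P j.*2; nth 0 P j.*2.+1] -> x \in P.
    by rewrite !inE => /or4P[] /eqP->; apply: nP; clear -iM jM; lia.
  by move=> x y /inP xP /inP yP; apply: rE.
- move=> i j iM jM ne; rewrite nested2_mono.
    have c0 : crossing by case: (D) (iM : i < size D) => // c l _; exact: c.
    rewrite /P /points !(nth_interleave_even _ _ _ _ _ c0) // !(nth_interleave_odd _ _ _ _ _ c0) //.
    have cij : compat (nth c0 D i) (nth c0 D j).
      by move: ne; rewrite neq_ltn => /orP[] lt; last rewrite compatC;
        apply: (pairwiseP c0 cmp) => //; rewrite inE.
    have /and3P[_ hi1 _] := allP bnd _ (mem_nth c0 (iM : i < size D)).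
    have /and3P[_ hj1 _] := allP bnd _ (mem_nth c0 (jM : j < size D)).
    exact: compat_nested2.
  have inP x : x \in [:: nth 0 P i.*2.+1; nth 0 P i.*2.+2;
                     nth 0 P j.*2.+1; nth 0 P j.*2.+2] -> x \in P.
    by rewrite !inE => /or4P[] /eqP->; apply: nP; clear -iM jM; lia.
  by move=> x y /inP xP /inP yP; apply: rE.
Qed.

End Diagram.

(** * Reading a diagram off a planar tuple *)

Section OfTuple.
Variables (n : nat) (p : nat -> nat).

(** Crossing number [x.2] occupies the 0-based indices [x.2.*2.+1] and [x.2.*2.+2] of the expansion.
    An inverse letter meets the side $\bar t_k$ first, hence the exchange. *)
Definition cross_of (x : letter n * nat) : crossing n :=
  (x.1, if x.1.2 then (p x.2.*2.+2, p x.2.*2.+1) else (p x.2.*2.+1, p x.2.*2.+2)).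

Lemma arcs_cross_of (w : word n) o :
  arcs (p o.*2) [seq cross_of x | x <- zip w (iota o (size w))] (p (o + size w).*2.+1) =
  [seq (p i.*2, p i.*2.+1) | i <- iota o (size w).+1].
Proof.
elim: w o => [|a w IH] o /=; first by rewrite addn0.
have -> : ent (cross_of (a, o)) = p o.*2.+1 by rewrite /ent /cross_of; case: a => k [].
have -> : ext (cross_of (a, o)) = p o.+1.*2 by rewrite /ext /cross_of; case: a => k [].
by rewrite addnS -addSn IH.
Qed.

End OfTuple.

Lemma planar_tuple_diagram n (w : word n) :
  planar_tuple (whitehead w) -> exists s D e, diagram s D e /\ map fst D = w.
Proof.
case=> M [szM [p [_ pinj pmon nin nout]]].
have E : M = (size w).+1 by move: szM; rewrite /whitehead size_interleave; clear; lia.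
rewrite {M szM}E in pinj pmon nin nout.
set m := size w in pinj pmon nin nout.
(* Contrapositive of the monotonicity of [p], made strict by injectivity. *)
have pstr i j : i < m.+1.*2 -> j < m.+1.*2 ->
    nth 0 (whitehead w) i < nth 0 (whitehead w) j -> p i < p j.
  move=> iM jM lt; rewrite ltnNge leq_eqVlt; apply/norP; split.
    by apply: contraL lt => /eqP /pinj -> //; rewrite ltnn.
  by apply: contraL lt => /(pmon _ _ jM iM); rewrite -leqNgt.
pose D := [seq cross_of p x | x <- zip w (iota 0 m)].
have szz : size (zip w (iota 0 m)) = m by rewrite size_zip size_iota minnn.
have whE i (a0 : letter n) : i < m ->
    nth 0 (whitehead w) i.*2.+1 = code (nth a0 w i) /\
    nth 0 (whitehead w) i.*2.+2 = code (linv (nth a0 w i)).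
  by move=> im; rewrite (nth_interleave_odd _ _ _ _ _ a0) // (nth_interleave_even _ _ _ _ _ a0).
have wh0 : nth 0 (whitehead w) 0 = 0 by [].
have whl : nth 0 (whitehead w) m.*2.+1 = n.*2.+1 by rewrite nth_interleave_last.
move: (whitehead w) pmon pstr whE wh0 whl => W _ pstr whE wh0 whl.
have facts (a0 : letter n) i j (a := nth a0 w i) (b := nth a0 w j)
    (c := cross_of p (a, i)) (d := cross_of p (b, j)) : i < m -> j < m ->
    [/\ p 0 < lo c, hi c < p m.*2.+1, lbl c = a.1, (lbl c < lbl d -> hi c < lo d) &
        (lbl c = lbl d -> lo c < hi d)].
  move=> im jm; have [oi ei] := whE i a0 im; have [oj ej] := whE j a0 jm.
  have an : a.1 < n by exact: ltn_ord.
  have bn : b.1 < n by exact: ltn_ord.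
  rewrite -/a /code /linv in oi ei; rewrite -/b /code /linv in oj ej.
  rewrite /c /d /lo /hi /lbl /cross_of /=.
  by case: (a.2) oi ei => /= oi ei; case: (b.2) oj ej => /= oj ej;
    split=> //; try move=> lab; apply: pstr;
    rewrite ?wh0 ?whl ?oi ?ei ?oj ?ej; try move: lab; move: im jm an bn; clear; lia.
exists (p 0), D, (p m.*2.+1); split; last by rewrite -map_comp -[RHS](@unzip1_zip _ _ _ (iota 0 m)) ?size_iota.
apply/and4P; split.
- apply: pstr; by rewrite ?wh0 ?whl //; clear; lia.
- apply/allP => c /mapP[x /(nthP (x.1, 0))[i]]; rewrite szz => im <- ->.
  rewrite nth_zip ?size_iota // nth_iota // add0n.
  have [h1 h2 h3 _ h4] := facts x.1 i i im im.
  by apply/and3P; split => //; apply: h4.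
- rewrite pairwise_map; have [w0|[a0 _]] : w = [::] \/ exists a0 : letter n, true.
    by case: (w) => [|a l]; [left | right; exists a].
    by rewrite {1}w0; case: (iota 0 m).
  apply/(pairwiseP (a0, 0)) => i j; rewrite !inE szz => im jm ij.
  rewrite /relpre /= !nth_zip ?size_iota // !nth_iota // !add0n.
  have [_ _ _ h1 h2] := facts a0 i j im jm; have [_ _ _ h3 h4] := facts a0 j i jm im.
  have [_ _ _ _ h5] := facts a0 i i im im; have [_ _ _ _ h6] := facts a0 j j jm jm.
  (* On a common cut every [lo] precedes every [hi]; disjoint intervals being excluded, nestedness
     leaves only the concentric configuration. *)
  have := nout i j; rewrite !ltnS => /(_ im jm); rewrite neq_ltn ij => /(_ isT).
  move: h1 h2 h3 h4 h5 h6; rewrite /compat /lbl /= nested2E.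
  rewrite /lo /hi /cross_of /=.
  case: ((nth a0 w i).2) => /=; case: ((nth a0 w j).2) => /=;
  move: ((nth a0 w i).1 : nat) ((nth a0 w j).1 : nat) (p i.*2.+1) (p i.*2.+2) (p j.*2.+1) (p j.*2.+2);
  clear; lia.
have := arcs_cross_of p w 0; rewrite add0n double0 -/m -/D => ->.
rewrite pairwise_map; apply/(pairwiseP 0) => i j; rewrite !inE size_iota => im jm ij.
by rewrite !nth_iota // !add0n; apply: nin => //; rewrite neq_ltn ij.
Qed.

Lemma planar_diagram n (w : word n) :
  planar w -> exists s D e, diagram s D e /\ map fst D = reduce w.
Proof. exact: planar_tuple_diagram. Qed.

(** * Removing folds *)

Lemma pairwise_mem (T : eqType) (r : rel T) (l : seq T) : symmetric r -> pairwise r l ->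
  forall x y, x \in l -> y \in l -> x = y \/ r x y.
Proof.
move=> sr; elim: l => //= a l IH /andP[/allP al /IH pl] x y; rewrite !inE.
case/predU1P=> [->|xl]; case/predU1P=> [->|yl]; [by left | | | exact: pl].
  by right; apply: al.
by right; rewrite sr; apply: al.
Qed.

(** The points [p] and [y] lie on one side of the chord from [c] to [d], and so do [z] and [q];
    since neither [c] nor [d] separates [y] from [z], all four lie on the same side. *)
Lemma nested2_join p y z q c d :
  nested2 p y c d -> nested2 z q c d -> nested2 p y z q ->
  ~~ sbetween c y z -> ~~ sbetween d y z -> nested2 p q c d.
Proof.
rewrite -[nested2 p y c d]/(nest (p, y) (c, d)) -[nested2 z q c d]/(nest (z, q) (c, d)).
rewrite -[nested2 p q c d]/(nest (p, q) (c, d)) !(nestC _ (c, d)) /nest /= /nested2 /= !inE !negb_or !andbT.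
case/andP => /and3P[/and3P[cd cp cy] /andP[dp dy] py] /eqP Ep.
case/andP => /and3P[/and3P[_ cz cq] /andP[dz dq] zq] /eqP Eq.
case/andP => /and3P[/and3P[_ _ pq] _ _] _ bc bd.
rewrite cd cp cq dp dq pq Ep -Eq /=; move: cy dy cz dz bc bd; rewrite /sbetween; clear; lia.
Qed.

Section Folds.
Variable n : nat.
Implicit Types (c d a b : crossing n) (D A : seq (crossing n)).

(** [L] and [p] are chosen before [D2], so they describe the arcs both before and after the deletion
    of a fold. *)
Lemma arcs_cat s D1 e : exists L p, forall D2, arcs s (D1 ++ D2) e = L ++ arcs p D2 e.
Proof.
elim: D1 s => [|c D1 IH] s; first by exists [::], s.
by have [L [p h]] := IH (ext c); exists ((s, ent c) :: L), p => D2; rewrite /= h.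
Qed.

Lemma arcs_head D e : exists q R, forall x, arcs x D e = (x, q) :: R.
Proof. by case: D => [|c D]; [exists e, [::] | exists (ent c), (arcs (ext c) D e)]. Qed.

Lemma mem_arcs_ext s D e c : c \in D -> exists y, (ext c, y) \in arcs s D e.
Proof.
elim: D s => //= d D IH s; rewrite inE => /predU1P[->|/(IH (ext d))[y h]].
  by have [q [R E]] := arcs_head D e; exists q; rewrite E !inE eqxx orbT.
by exists y; rewrite inE h orbT.
Qed.

Lemma mem_arcs_ent s D e c : c \in D -> exists x, (x, ent c) \in arcs s D e.
Proof.
elim: D s => //= d D IH s; rewrite inE => /predU1P[->|/(IH (ext d))[x h]].
  by exists s; rewrite inE eqxx.
by exists x; rewrite inE h orbT.
Qed.

Lemma arcs_consecutive s D e x y : (x, y) \in arcs s D e ->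
  [\/ y = e, (exists c D', D = c :: D' /\ (x, y) = (s, ent c)) |
      exists A a b A', [/\ D = A ++ a :: b :: A', x = ext a & y = ent b]].
Proof.
elim: D s => [|c D IH] s /=; first by rewrite inE => /eqP[_ ->]; constructor 1.
rewrite inE => /predU1P[->|/IH[->|[d [D' [-> [-> ->]]]]|[A [a [b [A' [-> -> ->]]]]]]].
- by constructor 2; exists c, D.
- by constructor 1.
- by constructor 3; exists [::], c, d, D'.
- by constructor 3; exists (c :: A), a, b, A'.
Qed.

Definition bounded s e c := [&& s < lo c, lo c < hi c & hi c < e].

(** Coinciding positions are allowed on a common cut, so this holds for any two members of a
    diagram, equal or not. *)
Definition wcompat c d :=
  [|| (lbl c < lbl d) && (hi c < lo d), (lbl d < lbl c) && (hi d < lo c) |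
      (lbl c == lbl d) &&
      [|| (lo c < lo d) && (hi d < hi c), (lo d < lo c) && (hi c < hi d) |
          (lo c == lo d) && (hi c == hi d)]].

Lemma diagram_wcompat s D e c d : diagram s D e -> c \in D -> d \in D -> wcompat c d.
Proof.
case/and4P=> _ _ cmp _ cD dD.
case: (pairwise_mem (@compatC n) cmp cD dD) => [->|]; first by rewrite /wcompat !eqxx !orbT.
by rewrite /compat /wcompat; clear; lia.
Qed.

Lemma diagram_bounded s D e c : diagram s D e -> c \in D -> bounded s e c.
Proof. by case/and4P=> _ /allP h _ _; apply: h. Qed.

Lemma arcs_endpoint s D e r v : r \in arcs s D e ->
  v = r.1 \/ v = r.2 -> [\/ v = s, v = e | exists2 c, c \in D & v = ent c \/ v = ext c].
Proof.
case: r => x y /=; elim: D s => [|c D IH] s /=.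
  by rewrite inE => /eqP[-> ->] [] ->; [constructor 1 | constructor 2].
rewrite inE => /predU1P[[-> ->] [] ->|/IH h /h].
- by constructor 1.
- by constructor 3; exists c; rewrite ?mem_head //; left.
case=> [->|->|[d dD h']].
- by constructor 3; exists c; rewrite ?mem_head //; right.
- by constructor 2.
by constructor 3; exists d => //; rewrite inE dD orbT.
Qed.

Definition side (t : bool) c := if t then lo c else hi c.

Lemma entE c : ent c = side (~~ c.1.2) c.
Proof. by rewrite /ent /side; case: c.1.2. Qed.

Lemma extE c : ext c = side c.1.2 c.
Proof. by []. Qed.

(** No other side of the polygon comes between two points of one side of a cut; the reflection
    gluing then carries betweenness over to the opposite side. *)
Lemma between_side t u a b c :
  lbl b = lbl a -> lo a < hi a -> lo b < hi b -> lo c < hi c -> wcompat a c -> wcompat b c ->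
  sbetween (side u c) (side t a) (side t b) ->
  [/\ u = t, lbl c = lbl a & sbetween (side (~~ t) c) (side (~~ t) a) (side (~~ t) b)].
Proof.
rewrite /wcompat /side /sbetween => ->; move: (lbl a) (lbl c) (lo a) (hi a) (lo b) (hi b) (lo c) (hi c).
move=> k k' x y x' y' x2 y2 h1 h2 h3.
case/or3P=> [/andP[l1 l2]|/andP[l1 l2]|/andP[/eqP <- m1]];
case/or3P=> [/andP[l3 l4]|/andP[l3 l4]|/andP[/eqP l m2]]; try (exfalso; move: l1 l3; clear; lia);
  try (exfalso; move: l1 l; clear; lia); try (exfalso; move: l3; clear; lia);
  try (case: t; case: u => /= bt; exfalso; move: h1 h2 h3 l2 l4 bt; clear; lia).
case/or3P: m1 => /andP[m1 m1']; case/or3P: m2 => /andP[m2 m2'];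
case: t; case: u => /= bt; try (exfalso; move: h1 h2 h3 m1 m1' m2 m2' bt; clear; lia);
by split => //; move: h1 h2 h3 m1 m1' m2 m2' bt; clear; lia.
Qed.

(** [ent a] and [ext b] are the outer ends of the fold; its inner arc runs from [ext a] to
    [ent b]. *)
Definition clear_between D a b :=
  all (fun c => ~~ sbetween (ent c) (ent a) (ext b) && ~~ sbetween (ext c) (ent a) (ext b)) D.

(* A crossing that separates the two outer ends of a fold has its other end under the
   fold; noncrossing then forces a strictly smaller fold. *)
Lemma innermost_fold s D e A a b A' : diagram s D e ->
  D = A ++ a :: b :: A' -> b.1 = linv a.1 ->
  exists A a b A', [/\ D = A ++ a :: b :: A', b.1 = linv a.1 & clear_between D a b].
Proof.
(* The measure is the distance between the ends of the inner arc, written with truncated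
   subtractions. *)
move=> dg; have [N] := ubnP ((ext a - ent b) + (ent b - ext a)).
elim: N A a b A' => // N IH A a b A' gap DE ba.
case: (boolP (clear_between D a b)) => [cl|]; first by exists A, a, b, A'.
case/allPn=> c cD; rewrite negb_and !negbK => bad.
have aD : a \in D by rewrite DE mem_cat !inE eqxx !orbT.
have bD : b \in D by rewrite DE mem_cat !inE eqxx !orbT.
have ff : (ext a, ent b) \in arcs s D e.
  have [L [p h]] := arcs_cat s A e.
  by rewrite DE h mem_cat /= !inE eqxx !orbT.
have blbl : lbl b = lbl a by rewrite /lbl ba.
have bnd d : d \in D -> [/\ s < lo d, lo d < hi d & hi d < e].
  by move=> /(diagram_bounded dg)/and3P[].
have [sa la ea] := bnd a aD; have [sb lb eb] := bnd b bD; have [_ lc _] := bnd c cD.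
have bs t u d : d \in D -> sbetween (side u d) (side t a) (side t b) ->
    [/\ u = t, lbl d = lbl a & sbetween (side (~~ t) d) (side (~~ t) a) (side (~~ t) b)].
  move=> dD; have [_ ld _] := bnd d dD.
  by apply: between_side => //; apply: diagram_wcompat dg _ dD.
set t := a.1.2.
have Ea : ent a = side (~~ t) a := entE a.
have Xa : ext a = side t a := extE a.
have Eb : ent b = side t b by rewrite entE ba /= negbK.
have Xb : ext b = side (~~ t) b by rewrite extE ba.
have cin : sbetween (side t c) (side t a) (side t b).
  rewrite -{1 2 3}[t]negbK; move: bad; rewrite Ea Xb entE extE.
  by case/orP=> /(bs _ _ _ cD)[].
have [r rD rc] : exists2 r, r \in arcs s D e & r.1 = side t c \/ r.2 = side t c.
  have [y1 h1] := mem_arcs_ext s e cD; have [y2 h2] := mem_arcs_ent s e cD.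
  have [tc|tc] := eqVneq t c.1.2; [exists (ext c, y1) | exists (y2, ent c)] => //.
    by left; rewrite tc.
  by right; rewrite /= entE; move: tc; case: (t); case: c.1.2.
(* The arc [r] has one end strictly under the inner arc and does not cross it, so both its ends are
   there. *)
have rin : sbetween r.1 (side t a) (side t b) && sbetween r.2 (side t a) (side t b).
  have /and4P[_ _ _ nst] := dg; case: (pairwise_mem nestC nst ff rD) => [rE|].
    by move: rc cin; rewrite -rE /= Xa Eb /sbetween => -[->|->]; clear; lia.
  rewrite /nest /nested2 => /andP[_] /=; rewrite Xa Eb => /eqP E.
  by case: rc => rc; [rewrite -E | rewrite E]; rewrite rc cin.
case: r rD {rc} rin => x y rD /= /andP[xin yin].
have lt_s v : sbetween v (side t a) (side t b) -> s < v < e.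
  by rewrite /sbetween /side; case: (t); move: sa la ea sb lb eb; clear; lia.
(* As [s] and [e] are extreme, [r] is neither the first nor the last arc. It joins two consecutive
   crossings through the same side of the same cut, which is a narrower fold. *)
case: (arcs_consecutive rD) => [ye|[d [D' [_ [xs _]]]]|[A2 [a2 [b2 [A2' [DE2 xE yE]]]]]].
- by have := lt_s _ yin; rewrite ye ltnn andbF.
- by have := lt_s _ xin; rewrite xs ltnn.
have a2D : a2 \in D by rewrite DE2 mem_cat !inE eqxx !orbT.
have b2D : b2 \in D by rewrite DE2 mem_cat !inE eqxx !orbT.
rewrite xE extE in xin; rewrite yE entE in yin.
have [sa2 la2 _] := bs _ _ _ a2D xin; have [sb2 lb2 _] := bs _ _ _ b2D yin.
apply: (IH A2 a2 b2 A2') => //.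
  by move: gap xin yin; rewrite Xa Eb extE entE /sbetween; clear; lia.
have sb2' : b2.1.2 = ~~ a2.1.2 by rewrite sa2 -sb2 negbK.
rewrite /linv [LHS]surjective_pairing sb2'; congr (_, _).
by apply: val_inj; move: la2 lb2; rewrite /lbl /= => -> ->.
Qed.

(** Three arcs are replaced by a single one. No other arc has an end between the outer ends of the
    fold, so [nested2_join] applies. *)
Lemma delete_fold s e A a b A' : diagram s (A ++ a :: b :: A') e ->
  clear_between (A ++ a :: b :: A') a b -> diagram s (A ++ A') e.
Proof.
set D := A ++ _ => dg cl; have /and4P[se bnd cmp nst] := dg.
have subD : subseq (A ++ A') D.
  by apply: cat_subseq (subseq_refl _) _; apply: subseq_trans (subseq_cons _ b) (subseq_cons _ a).
apply/and4P; split => //.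
- by apply/allP => c /(mem_subseq subD) /(allP bnd).
- exact: subseq_pairwise subD cmp.
have [L [p EL]] := arcs_cat s A e; have [q [R ER]] := arcs_head A' e.
have DE : arcs s D e = L ++ (p, ent a) :: (ext a, ent b) :: (ext b, q) :: R.
  by rewrite /D EL /= ER.
have E : arcs s (A ++ A') e = L ++ (p, q) :: R by rewrite EL ER.
rewrite E (perm_pairwise nestC (permEl (perm_catCA L [:: (p, q)] R))) /=.
move: (nst); rewrite DE (perm_pairwise nestC (permEl (perm_catCA L [:: _; _; _] R))) /=.
case/and4P => /and3P[_ pq1 n1] _ n3 ->; rewrite andbT.
apply/allP => r rLR; move: (allP n1 _ rLR) (allP n3 _ rLR) pq1.
have rD : r \in arcs s D e by move: rLR; rewrite DE !mem_cat !inE => /orP[] ->; rewrite ?orbT.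
have nb v : v = r.1 \/ v = r.2 -> ~~ sbetween v (ent a) (ext b).
  have aD : a \in D by rewrite /D mem_cat !inE eqxx !orbT.
  have bD : b \in D by rewrite /D mem_cat !inE eqxx !orbT.
  have ba := diagram_bounded dg aD; have bb := diagram_bounded dg bD.
  move/(arcs_endpoint rD) => [->|->|[c cD h]].
  - move: ba bb; rewrite /bounded /sbetween /ent /ext.
    by case: a.1.2; case: b.1.2; clear; lia.
  - move: ba bb; rewrite /bounded /sbetween /ent /ext.
    by case: a.1.2; case: b.1.2; clear; lia.
  by have /andP[c1 c2] := allP cl _ cD; case: h => ->.
by move=> h1 h2 h3; apply: nested2_join h1 h2 h3 (nb _ (or_introl erefl)) (nb _ (or_intror erefl)).
Qed.

Lemma not_reduced_fold D : ~~ reduced (map fst D) ->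
  exists A a b A', D = A ++ a :: b :: A' /\ b.1 = linv a.1.
Proof.
elim: D => //= a [|b D] //= IH; rewrite negb_and negbK.
case: (eqVneq b.1 (linv a.1)) => [ba _|_ /IH]; first by exists [::], a, b, D.
by case=> A [a' [b' [A' [-> h]]]]; exists (a :: A), a', b', A'.
Qed.

Lemma diagram_planar s D e : diagram s D e -> planar (map fst D).
Proof.
have [N] := ubnP (size D); elim: N D => // N IH D szD dg.
case: (boolP (reduced (map fst D))) => [r|/not_reduced_fold[A [a [b [A' [DE ba]]]]]].
  by rewrite /planar reduce_id //; apply: diagram_planar_tuple dg.
have {A a b A' DE ba} [A [a [b [A' [DE ba cl]]]]] := innermost_fold dg DE ba.
rewrite DE in dg cl szD *.
have : planar (map fst (A ++ A')).
  by apply: IH (delete_fold dg cl); move: szD; rewrite !size_cat /=; lia.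
rewrite /planar !map_cat /= ba; suff -> : weq (map fst A ++ map fst A')
  (map fst A ++ a.1 :: linv a.1 :: map fst A') by [].
by apply: weq_catl; apply: weq_sym; apply: weq_cancel.
Qed.

End Folds.

(** * Braid generators acting on diagrams *)

Lemma nested2_swapl a b c d : nested2 a b c d = nested2 b a c d.
Proof. by rewrite !nested2E; lia. Qed.

Lemma nested2_swapr a b c d : nested2 a b c d = nested2 a b d c.
Proof. by rewrite !nested2E; lia. Qed.

Arguments nested2 : simpl never.

Section Expansion.
Variable n : nat.
Implicit Types (c d : crossing n) (D : seq (crossing n)).

(** Nestedness with the first arc includes distinct ends for every other arc; the first arc itself
    starts at the extreme position [s]. *)
Lemma arcs_neq s D e r : diagram s D e -> r \in arcs s D e -> r.1 != r.2.
Proof.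
case/and4P=> se /=; case: D => [_ _ _|c D /andP[bc _] _] /=.
  by rewrite inE => /eqP-> /=; move: se; clear; lia.
case/andP=> /allP nst _; rewrite inE => /predU1P[->|/nst].
  by move: bc; rewrite /= /ent; case: c.1.2; clear; lia.
by rewrite /nest nested2E => /and5P[_ _ _ _ /and3P[]].
Qed.

(** The witness is one past the largest among [s] and the positions on cuts below [k]. *)
Lemma threshold s D e k : diagram s D e ->
  exists2 B, s < B <= e & {in D, forall c, if lbl c < k then hi c < B else B <= lo c}.
Proof.
move=> dg; have /and4P[se _ _ _] := dg.
exists (maxn s.+1 (\max_(c <- D | lbl c < k) (hi c).+1)).
  rewrite leq_maxl geq_max se; apply/bigmax_leqP_seq => c cD _.
  by have /and3P[] := diagram_bounded dg cD.
move=> c cD; case: ifP => ck.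
  by rewrite leq_max (leq_bigmax_seq (F := fun d => (hi d).+1)) // orbT.
rewrite geq_max; have /and3P[-> _ _] := diagram_bounded dg cD.
apply/bigmax_leqP_seq => d dD dk; have := diagram_wcompat dg cD dD.
by move: ck dk; rewrite /wcompat; clear; lia.
Qed.

Variables (g : nat -> nat) (F : crossing n -> seq (crossing n)).
Variable X : crossing n -> seq (nat * nat).
Hypothesis gE : forall x y, (g x < g y) = (x < y).
Hypothesis arcsF : forall s c D e,
  arcs (g s) (F c ++ D) e = (g s, g (ent c)) :: X c ++ arcs (g (ext c)) D e.

Lemma arcs_expand s D e :
  perm_eq (arcs (g s) (flatten (map F D)) (g e))
          ([seq (g r.1, g r.2) | r <- arcs s D e] ++ flatten (map X D)).
Proof.
elim: D s => [|c D IH] s //=; rewrite arcsF perm_cons.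
rewrite perm_sym perm_catCA perm_cat2l perm_sym; exact: IH.
Qed.

(** The old arcs survive, moved by the monotone [g], and only the arcs [X c] are new; hence the
    hypotheses concern only pairs with a new arc or a new crossing. *)
Lemma diagram_expand s D e : diagram s D e ->
  {in D, forall c, [&& all (bounded (g s) (g e)) (F c), pairwise (@compat n) (F c),
     pairwise nest (X c) &
     all (fun x => all (fun r => nest (g r.1, g r.2) x) (arcs s D e)) (X c)]} ->
  {in D &, forall c d, compat c d ->
     allrel (@compat n) (F c) (F d) && allrel nest (X c) (X d)} ->
  diagram (g s) (flatten (map F D)) (g e).
Proof.
move=> dg h1 h2; have /and4P[se bnd cmp nst] := dg.
apply/and4P; split; first by rewrite gE.
- by apply/allP => x /flattenP[l /mapP[c /h1/and4P[/allP h _ _ _] ->]] /h.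
- apply: pairwise_flatten; first by apply/allP => c /h1/and4P[].
  apply: (@sub_in_pairwise _ [in D] (@compat n)) cmp; last by apply/allP.
  by move=> c d cD dD /(h2 c d cD dD) /andP[].
rewrite (perm_pairwise nestC (arcs_expand s D e)) pairwise_cat; apply/and3P; split.
- apply/allrelP => x y /mapP[r rD ->] /flattenP[l /mapP[c /h1/and4P[_ _ _ /allP h] ->]] /h.
  by move/allP/(_ r rD).
- rewrite pairwise_map; apply: sub_pairwise nst => a b /=.
  by rewrite /nest /= nested2_mono // => x y _ _; apply: gE.
apply: pairwise_flatten; first by apply/allP => c /h1/and4P[].
apply: (@sub_in_pairwise _ [in D] (@compat n)) cmp; last by apply/allP.
by move=> c d cD dD /(h2 c d cD dD) /andP[].
Qed.

End Expansion.

Section Twist.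
Variables (n : nat) (i j : 'I_n).
Hypothesis ij : j = i.+1 :> nat.

Definition twistL (k : 'I_n) : word n :=
  if k == i then [:: (i, false); (j, false); (i, true)]
  else if k == j then [:: (i, false)] else gen k.

Definition twistR (k : 'I_n) : word n :=
  if k == j then [:: (j, true); (i, false); (j, false)]
  else if k == i then [:: (j, false)] else gen k.

Variables (B N : nat).

(* The images of the generators are drawn by opening a gap of width [4 * N + 4] at
   position [B] and filling it with concentric arcs.  For [expL], the cut i becomes a
   curve parallel to the sides t_i, \bar t_i, t_j of the polygon: its outer side keeps the
   old positions and its inner side is mirrored in the gap (except for the points coming
   from t_j, which are glued to \bar t_j), followed there by a copy of the old cut i,
   relabelled j.  [expR] is the mirror image. *)
Definition spread x := if x < B then x else x + 4 * N + 4.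

Lemma spreadE x y : (spread x < spread y) = (x < y).
Proof. by rewrite /spread; do 2 case: ifP; lia. Qed.

Lemma spreadP x : (x < B) && (spread x == x) || (B <= x) && (spread x == x + 4 * N + 4).
Proof. by rewrite /spread; case: (ltnP x B) => _; rewrite eqxx. Qed.

Ltac unspread := repeat match goal with |- context [spread ?x] =>
  move: (spreadP x); move: (spread x) end.

(** Here and in [nestedR] the arcs are concentric about the point halfway between [B + N] and
    [B + N + 1]. *)
Lemma nestedL x y : x < B <= N -> y < B -> x != y ->
  nested2 (B + N - x) (B + N + 1 + x) (B + N - y) (B + N + 1 + y).
Proof. by rewrite nested2E; case: (ltngtP x y) => // lt h1 h2 _; lia. Qed.

Lemma nestedR x y : x <= N -> y <= N -> x != y ->
  nested2 (B + 2 * N + 1 - x) (B + x) (B + 2 * N + 1 - y) (B + y).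
Proof. by rewrite nested2E; case: (ltngtP x y) => // lt h1 h2 _; lia. Qed.

Lemma spread_lo x : x < B -> spread x = x.
Proof. by rewrite /spread => ->. Qed.

Lemma spread_hi x : B <= x -> spread x = x + 4 * N + 4.
Proof. by rewrite /spread ltnNge => ->. Qed.

Ltac fixspread := repeat match goal with |- context [spread ?z] =>
  let E := fresh in
  first [ have E : spread z = z by apply: spread_lo; lia
        | have E : spread z = z + 4 * N + 4 by apply: spread_hi; lia ]; rewrite !E {E} end.

Ltac crush := repeat (apply/andP; split=> //); lia.

Definition expL (c : crossing n) : seq (crossing n) :=
  if c.1.1 == i then
    [:: ((i, false), (spread (ent c), B + N - ent c));
        ((j, c.1.2), (B + N + 1 + lo c, B + N + 1 + hi c));
        ((i, true), (spread (ext c), B + N - ext c))]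
  else [:: ((if c.1.1 == j then i else c.1.1, c.1.2), (spread (lo c), spread (hi c)))].

Definition arcsL (c : crossing n) :=
  if c.1.1 == i then [:: (B + N - ent c, B + N + 1 + ent c); (B + N + 1 + ext c, B + N - ext c)]
  else [::].

Lemma arcs_expL s c D e :
  arcs (spread s) (expL c ++ D) e =
  (spread s, spread (ent c)) :: arcsL c ++ arcs (spread (ext c)) D e.
Proof.
by rewrite /expL /arcsL; case: ifP => _; rewrite /ent /ext; case: c.1.2.
Qed.

Lemma word_expL c : map fst (expL c) = img twistL c.1.
Proof.
rewrite /expL /img /twistL; case: c => -[k []] x /=; rewrite /winv /gen;
  by case: ifP => // _; case: ifP => // /eqP->.
Qed.

Definition expR (c : crossing n) : seq (crossing n) :=
  if c.1.1 == j then
    [:: ((j, true), (B + 2 * N + 1 - ent c, spread (ent c)));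
        ((i, c.1.2), (B + lo c, B + hi c));
        ((j, false), (B + 2 * N + 1 - ext c, spread (ext c)))]
  else [:: ((if c.1.1 == i then j else c.1.1, c.1.2), (spread (lo c), spread (hi c)))].

Definition arcsR (c : crossing n) :=
  if c.1.1 == j then [:: (B + 2 * N + 1 - ent c, B + ent c); (B + ext c, B + 2 * N + 1 - ext c)]
  else [::].

Lemma arcs_expR s c D e :
  arcs (spread s) (expR c ++ D) e =
  (spread s, spread (ent c)) :: arcsR c ++ arcs (spread (ext c)) D e.
Proof.
by rewrite /expR /arcsR; case: ifP => _; rewrite /ent /ext; case: c.1.2.
Qed.

Lemma word_expR c : map fst (expR c) = img twistR c.1.
Proof.
rewrite /expR /img /twistR; case: c => -[k []] x /=; rewrite /winv /gen;
  by case: ifP => // _; case: ifP => // /eqP->.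
Qed.

(** The threshold [j.+1] opens the gap just after the sides of the cut [j]; since [e <= N], the
    mirrored positions fit into the gap. *)
Lemma diagram_expL s D e : diagram s D e -> s < B <= e -> e <= N ->
  {in D, forall c, if lbl c < j.+1 then hi c < B else B <= lo c} ->
  diagram (spread s) (flatten (map expL D)) (spread e).
Proof.
move=> dg BN eN thr; apply: (diagram_expand spreadE arcs_expL dg).
  move=> c cD; have := thr c cD; have /and3P := diagram_bounded dg cD.
  rewrite /expL /arcsL; have [ci|ci] := eqVneq c.1.1 i.
    have -> : (lbl c < j.+1) = true by rewrite /lbl ci ?ij; clear; lia.
    move=> [h1 h2 h3] h4; apply/and4P; split.
    - rewrite /bounded /= /ent /ext; move: eN BN h1 h2 h3 h4; rewrite /lo /hi.
      by case: c.1.2 => /=; unspread; clear; lia.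
    - rewrite /compat /= /lbl /ent /ext; move: ij eN BN h1 h2 h3 h4; rewrite /lo /hi.
      by case: c.1.2 => /=; unspread; clear; lia.
    - rewrite /= /nest nested2E /=; move: eN BN h1 h2 h3 h4; rewrite /ent /ext.
      by case: c.1.2; unspread; clear; lia.
    (* A new arc lies inside the gap, which no old position enters, so it cannot cross an old arc;
       [arcs_neq] supplies the distinct ends that [nested2] also demands. *)
    - apply/allP => x xX; apply/allP => r /(arcs_neq dg); move: xX.
      rewrite !inE => /orP[]/eqP->; rewrite /nest nested2E /=;
        move: eN BN h1 h2 h3 h4; rewrite /ent /ext; move: (r.1 : nat) (r.2 : nat) => x1 x2;
        by case: c.1.2; unspread; clear; lia.
  move=> [h1 h2 h3] h4; rewrite /= !andbT /bounded /lo /hi /= -/(lo c) -/(hi c) !spreadE.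
  by rewrite h1 h2 h3.
move=> c d cD dD; have := thr c cD; have := thr d dD.
have /and3P := diagram_bounded dg cD; have /and3P := diagram_bounded dg dD.
move=> [_ h1 h2] [_ h3 h4] t1 t2 cmp; apply/andP; split; last first.
  move: cmp t1 t2 h1 h2 h3 h4; rewrite /arcsL /compat.
  have [ci|ci] := eqVneq c.1.1 i; have [di|di] := eqVneq d.1.1 i; rewrite ?allrel0l ?allrel0r //.
  rewrite /lbl ci di ltnn eqxx /=.
  have -> : (i < j.+1) = true by rewrite ?ij; clear; lia.
  rewrite /allrel /nest /= !andbT => cmp t1 t2 h1 h2 h3 h4.
  (* The two new arcs of a crossing run in opposite directions, so they are first oriented as in
     [nestedL]. *)
  by apply/andP; split; apply/andP; split;
    rewrite ?[nested2 (_ + _) _ _ _]nested2_swapl ?[nested2 _ _ (_ + _) _]nested2_swapr;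
    apply: nestedL; move: cmp t1 t2 h1 h2 h3 h4 BN eN; rewrite /ent /ext;
    case: c.1.2; case: d.1.2; clear; lia.
have {}t1 : (lbl d < j.+1) && (hi d < B) || (j.+1 <= lbl d) && (B <= lo d).
  by move: t1; case: ltnP => _ ->.
have {}t2 : (lbl c < j.+1) && (hi c < B) || (j.+1 <= lbl c) && (B <= lo c).
  by move: t2; case: ltnP => _ ->.
move: cmp t1 t2 h1 h2 h3 h4; rewrite /expL /allrel /compat /ent /ext /lbl /lo /hi.
case: c d {cD dD} => [[k b] [x y]] [[k' b'] [x' y']] /=; clear dg thr.
have [->|ck] := eqVneq k i; have [->|dk] := eqVneq k' i; rewrite /=.
- rewrite ltnn eqxx /= => cmp t1 t2 h1 h2 h3 h4.
  by case: b; case: b'; fixspread; case/orP: cmp => /andP[c1 c2]; crush.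
- have dn : k' != i :> nat by [].
  have [->|dj] := eqVneq k' j => /= cmp t1 t2 h1 h2 h3 h4.
    by case: b; fixspread; crush.
  have dm : k' != j :> nat by [].
  (* Any other cut is entirely before or after the pair, which decides both the order of the labels
     and the side of the gap. *)
  have [lt|lt] : k' < i \/ j < k' by clear -ij dn dm; lia.
    by case: b; fixspread; crush.
  by case: b; fixspread; crush.
- have dn : k != i :> nat by [].
  have [->|dj] := eqVneq k j => /= cmp t1 t2 h1 h2 h3 h4.
    by case: b'; fixspread; crush.
  have dm : k != j :> nat by [].
  have [lt|lt] : k < i \/ j < k by clear -ij dn dm; lia.
    by case: b'; fixspread; crush.
  by case: b'; fixspread; crush.
have cn : k != i :> nat by [].
have dn : k' != i :> nat by [].
move: ij cn dn; rewrite !spreadE; have [->|cj] := eqVneq k j; have [->|dj] := eqVneq k' j => /=.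
- by clear; lia.
- have dm : k' != j :> nat by [].
  by move: dm; clear; lia.
- have cm : k != j :> nat by [].
  by move: cm; clear; lia.
- by clear; lia.
Qed.

(** In the mirror image the threshold [i] opens the gap just before the sides of the cut [i]. *)
Lemma diagram_expR s D e : diagram s D e -> s < B <= e -> e <= N ->
  {in D, forall c, if lbl c < i then hi c < B else B <= lo c} ->
  diagram (spread s) (flatten (map expR D)) (spread e).
Proof.
move=> dg BN eN thr; apply: (diagram_expand spreadE arcs_expR dg).
  move=> c cD; have := thr c cD; have /and3P := diagram_bounded dg cD.
  rewrite /expR /arcsR; have [ci|ci] := eqVneq c.1.1 j.
    have -> : (lbl c < i) = false by rewrite /lbl ci ?ij; clear; lia.
    move=> [h1 h2 h3] h4; apply/and4P; split.
    - rewrite /bounded /= /ent /ext; move: eN BN h1 h2 h3 h4; rewrite /lo /hi.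
      by case: c.1.2 => /=; unspread; clear; lia.
    - rewrite /compat /= /lbl /ent /ext; move: ij eN BN h1 h2 h3 h4; rewrite /lo /hi.
      by case: c.1.2 => /=; unspread; clear; lia.
    - rewrite /= /nest nested2E /=; move: eN BN h1 h2 h3 h4; rewrite /ent /ext.
      by case: c.1.2; unspread; clear; lia.
    - apply/allP => x xX; apply/allP => r /(arcs_neq dg); move: xX.
      rewrite !inE => /orP[]/eqP->; rewrite /nest nested2E /=;
        move: eN BN h1 h2 h3 h4; rewrite /ent /ext; move: (r.1 : nat) (r.2 : nat) => x1 x2;
        by case: c.1.2; unspread; clear; lia.
  move=> [h1 h2 h3] h4; rewrite /= !andbT /bounded /lo /hi /= -/(lo c) -/(hi c) !spreadE.
  by rewrite h1 h2 h3.
move=> c d cD dD; have := thr c cD; have := thr d dD.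
have /and3P := diagram_bounded dg cD; have /and3P := diagram_bounded dg dD.
move=> [_ h1 h2] [_ h3 h4] t1 t2 cmp; apply/andP; split; last first.
  move: cmp t1 t2 h1 h2 h3 h4; rewrite /arcsR /compat.
  have [ci|ci] := eqVneq c.1.1 j; have [di|di] := eqVneq d.1.1 j; rewrite ?allrel0l ?allrel0r //.
  rewrite /lbl ci di ltnn eqxx /=.
  have -> : (j < i) = false by rewrite ?ij; clear; lia.
  rewrite /allrel /nest /= !andbT => cmp t1 t2 h1 h2 h3 h4.
  by apply/andP; split; apply/andP; split;
    rewrite ?[nested2 (_ + _) _ _ _]nested2_swapl ?[nested2 _ _ (_ + _) _]nested2_swapr;
    apply: nestedR; move: cmp t1 t2 h1 h2 h3 h4 BN eN; rewrite /ent /ext;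
    case: c.1.2; case: d.1.2; clear; lia.
have {}t1 : (lbl d < i) && (hi d < B) || (i <= lbl d) && (B <= lo d).
  by move: t1; case: ltnP => _ ->.
have {}t2 : (lbl c < i) && (hi c < B) || (i <= lbl c) && (B <= lo c).
  by move: t2; case: ltnP => _ ->.
move: cmp t1 t2 h1 h2 h3 h4; rewrite /expR /allrel /compat /ent /ext /lbl /lo /hi.
case: c d {cD dD} => [[k b] [x y]] [[k' b'] [x' y']] /=; clear dg thr.
have [->|ck] := eqVneq k j; have [->|dk] := eqVneq k' j; rewrite /=.
- rewrite ltnn eqxx /= => cmp t1 t2 h1 h2 h3 h4.
  by case: b; case: b'; fixspread; case/orP: cmp => /andP[c1 c2]; crush.
- have dn : k' != j :> nat by [].
  have [->|dj] := eqVneq k' i => /= cmp t1 t2 h1 h2 h3 h4.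
    by case: b; fixspread; crush.
  have dm : k' != i :> nat by [].
  have [lt|lt] : k' < i \/ j < k' by clear -ij dn dm; lia.
    by case: b; fixspread; crush.
  by case: b; fixspread; crush.
- have dn : k != j :> nat by [].
  have [->|dj] := eqVneq k i => /= cmp t1 t2 h1 h2 h3 h4.
    by case: b'; fixspread; crush.
  have dm : k != i :> nat by [].
  have [lt|lt] : k < i \/ j < k by clear -ij dn dm; lia.
    by case: b'; fixspread; crush.
  by case: b'; fixspread; crush.
have cn : k != j :> nat by [].
have dn : k' != j :> nat by [].
move: ij cn dn; rewrite !spreadE; have [->|cj] := eqVneq k i; have [->|dj] := eqVneq k' i => /=.
- by clear; lia.
- have dm : k' != i :> nat by [].
  by move: dm; clear; lia.
- have cm : k != i :> nat by [].
  by move: cm; clear; lia.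
- by clear; lia.
Qed.

End Twist.

Lemma planar_weq n (u v : word n) : weq u v -> planar u -> planar v.
Proof. by rewrite /planar => ->. Qed.

Lemma planar_twistL n (i j : 'I_n) (w : word n) : j = i.+1 :> nat ->
  planar w -> planar (sub (twistL i j) w).
Proof.
move=> ij /planar_diagram[s [D [e [dg Dw]]]].
have [B BN thr] := threshold j.+1 dg.
(* The final position [e] bounds all others and serves as [N]. *)
have /diagram_planar := diagram_expL ij dg BN (leqnn e) thr.
apply: planar_weq; rewrite map_flatten -map_comp (eq_map (@word_expL n i j B e)).
by rewrite (map_comp (img _)) Dw; apply: weq_sub; apply: weq_reduce.
Qed.

Lemma planar_twistR n (i j : 'I_n) (w : word n) : j = i.+1 :> nat ->
  planar w -> planar (sub (twistR i j) w).
Proof.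
move=> ij /planar_diagram[s [D [e [dg Dw]]]].
have [B BN thr] := threshold i dg.
have /diagram_planar := diagram_expR ij dg BN (leqnn e) thr.
apply: planar_weq; rewrite map_flatten -map_comp (eq_map (@word_expR n i j B e)).
by rewrite (map_comp (img _)) Dw; apply: weq_sub; apply: weq_reduce.
Qed.

Lemma planar_gen n (k : 'I_n) : planar (gen k).
Proof. by apply: (@diagram_planar n 0 [:: ((k, false), (1, 2))] 3). Qed.

(** * Artin's descent *)

Section Artin.
Variable n : nat.
Implicit Types (u v w x y : word n) (g k : 'I_n) (a b : 'I_n * word n).

Definition conjw u x := winv x ++ u ++ x.

Lemma weq_mid u v w : weq (u ++ v ++ winv v ++ w) (u ++ w).
Proof. by apply: weq_catl; rewrite catA; apply: (@weq_catr _ _ _ [::]); apply: weq_catV. Qed.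

Lemma weq_conjw u x y : weq x y -> weq (conjw u x) (conjw u y).
Proof. by move=> h; apply: weq_cat; [apply: weq_winv | apply: weq_catl]. Qed.

(** The last clause is the maximality of [w]: no further cancellation takes place between [u] and
    [winv v]. *)
Lemma common_suffix x y : exists u v w, [/\ x = u ++ w, y = v ++ w &
  forall u' v' c, u = rcons u' c -> v <> rcons v' c].
Proof.
elim/last_ind: x y => [|x c IH] y.
  by exists [::], y, [::]; split; rewrite ?cats0 // => -[].
case/lastP: y => [|y d].
  by exists (rcons x c), [::], [::]; split; rewrite ?cats0 // => ? [].
have [<-|cd] := eqVneq c d.
  have [u [v [w [-> -> h]]]] := IH y.
  by exists u, v, (rcons w c); rewrite -!rcons_cat.
exists (rcons x c), (rcons y d), [::]; split; rewrite ?cats0 //.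
by move=> u' v' c' /rcons_inj[_ <-] /rcons_inj[_ dc]; rewrite dc eqxx in cd.
Qed.

(** In $x_a^{-1} t_a x_a \, x_b^{-1} t_b x_b$ the letter $t_a$ is absorbed when $x_b$ ends with $t_a
    x_a$, and $t_b$ when $x_a$ ends with $t_b^{-1} x_b$. *)
Definition nonabsorbing a b :=
  ~~ suffix ((a.1, false) :: a.2) b.2 && ~~ suffix ((b.1, true) :: b.2) a.2.

Definition conj_product l := flatten [seq conjw (gen a.1) a.2 | a <- l].

(* When no central letter is absorbed by a neighbour, all of them survive in the
   reduced product. *)
Lemma reduce_conj_product a l :
  all (fun b => reduced (conjw (gen b.1) b.2)) (a :: l) -> sorted nonabsorbing (a :: l) ->
  exists r, [/\ reduce (conj_product (a :: l)) = winv a.2 ++ (a.1, false) :: r,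
    size l <= size r & size r = size l -> all (fun b => b.2 == a.2) l].
Proof.
elim: l a => [|b l IH] a /=.
  by rewrite andbT /conj_product /= cats0 => r _; exists a.2; split; rewrite // reduce_id.
case/andP=> ra rl /andP[/andP[ab ba] sl].
have [r [rE sz eqr]] := IH b rl sl.
have [u [v [z [xE yE uv]]]] := common_suffix a.2 b.2.
(* Once the common suffix cancels, [u ++ winv v] is what remains between the two central letters. *)
exists (u ++ winv v ++ (b.1, false) :: r); split; last 1 first.
- rewrite !size_cat size_winv => h.
  have {}h : size u + (size v + (size r).+1) = (size l).+1 := h.
  have {}sz : size l <= size r := sz.
  have u0 : u = [::] by apply: size0nil; move: h sz; clear; lia.
  have v0 : v = [::] by apply: size0nil; move: h sz; clear; lia.
  have ba2 : b.2 = a.2 by rewrite xE yE u0 v0.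
  by rewrite ba2 eqxx -ba2; apply: eqr; move: h sz; clear; lia.
- set W := winv a.2 ++ _.
  have -> : reduce (conj_product [:: a, b & l]) = reduce W.
    rewrite -[LHS]/(reduce (conjw (gen a.1) a.2 ++ conj_product (b :: l))).
    apply: (@weq_trans _ _ (conjw (gen a.1) a.2 ++ winv b.2 ++ (b.1, false) :: r)).
      by apply: weq_catl; rewrite -rE; apply: weq_sym; apply: weq_reduce.
    rewrite /conjw /W {2}xE yE winv_cat -!catA; apply: weq_catl; rewrite /=.
    by rewrite -!cat_cons; apply: weq_mid.
  apply: reduce_id; rewrite /W {W} -cat_cons catA reduced_cat.
  move: ra; rewrite /conjw {2}xE !catA reduced_cat -catA => /and3P[-> _ _].
  have := reduced_reduce (conj_product (b :: l)).
  rewrite rE yE winv_cat -catA reduced_cat => /and3P[_ -> _] /=.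
  (* The junctions are reduced: two central letters are both positive, a central letter next to [u]
     or [winv v] survives by nonabsorption, and [u] meets [winv v] without cancellation by
     maximality. *)
  case/lastP: v yE uv => [|v d] yE uv; case/lastP: u xE uv => [|u c] xE uv.
  + by case: (winv a.2) => [|? ?] //=; rewrite ?last_cat /= /linv xpair_eqE andbF.
  + have ne : (b.1, false) != linv c.
      apply: contra ba => /eqP cE; have -> : (b.1, true) = c.
        by rewrite -[c]linvK -cE.
      by rewrite xE yE cat_rcons; apply: suffix_suffix.
    by case: (winv a.2) => [|? ?] /=; rewrite ?last_cat /= last_rcons.
  + have ne : linv d != linv (a.1, false).
      rewrite (inj_eq (inv_inj (@linvK n))); apply: contra ab => /eqP <-.
      by rewrite xE yE cat_rcons; apply: suffix_suffix.
    by rewrite winv_rcons; case: (winv a.2) => [|? ?] //=; rewrite last_cat.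
  have ne : linv d != linv c.
    rewrite (inj_eq (inv_inj (@linvK n))); apply/eqP => dc.
    by apply: (uv u v c) => //; rewrite dc.
  by rewrite winv_rcons; case: (winv a.2) => [|? ?] /=; rewrite ?last_cat /= last_rcons.
by rewrite !size_cat /=; move: sz; clear; lia.
Qed.

End Artin.

(** * Twists preserve the product of the generators; the terminal case of the descent *)

Section Descent.
Variable n : nat.
Implicit Types (f x : 'I_n -> word n) (s : 'I_n -> 'I_n) (w : word n) (i j k : 'I_n).

Definition gens : word n := [seq (k, false) | k <- enum 'I_n].

Lemma enum_ord_split i j : j = i.+1 :> nat ->
  exists A B, [/\ enum 'I_n = A ++ i :: j :: B, {in A, forall k, (k != i) && (k != j)} &
                  {in B, forall k, (k != i) && (k != j)}].
Proof.
move=> ij; exists (take i (enum 'I_n)), (drop j.+1 (enum 'I_n)).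
have E : enum 'I_n = take i (enum 'I_n) ++ i :: j :: drop j.+1 (enum 'I_n).
  rewrite -{1}(cat_take_drop i (enum 'I_n)) (drop_nth i) ?size_enum_ord // nth_ord_enum -ij.
  by rewrite (drop_nth i) ?size_enum_ord // nth_ord_enum.
have := enum_uniq 'I_n; rewrite {1}E cat_uniq => /and3P[_ /hasPn hA /= /andP[]].
rewrite inE negb_or => /andP[_ iB] /andP[jB _].
split=> // k kA; apply/andP; split; apply: contraTneq kA => ->.
- by apply: hA; rewrite mem_head.
- by apply: hA; rewrite !inE eqxx orbT.
- by [].
- by [].
Qed.

Lemma sub_gens_fixed f (A : seq 'I_n) : {in A, forall k, f k = gen k} ->
  sub f [seq (k, false) | k <- A] = [seq (k, false) | k <- A].
Proof.
elim: A => //= k A IH h; rewrite sub_cons IH => [|l lA]; last by apply: h; rewrite inE lA orbT.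
by rewrite /img /= h ?mem_head.
Qed.

(** Only the block $t_i t_j$ changes, into $t_i t_j t_i^{-1} t_i$. *)
Lemma sub_twistL_gens i j : j = i.+1 :> nat -> weq (sub (twistL i j) gens) gens.
Proof.
move=> ij; have [A [B [E hA hB]]] := enum_ord_split ij.
have ji : (j == i) = false by apply/eqP => /(congr1 val) /=; rewrite ij; lia.
have tw k : (k != i) && (k != j) -> twistL i j k = gen k.
  by rewrite /twistL => /andP[/negbTE-> /negbTE->].
rewrite /gens E !map_cat /= sub_cat !sub_cons !sub_gens_fixed; last 2 first.
- by move=> k /hB /tw.
- by move=> k /hA /tw.
apply: weq_catl; rewrite /img /= /twistL eqxx ji eqxx /=.
by do 2 apply: weq_cons; apply: (weq_cancel (i, true)).
Qed.

Lemma sub_twistR_gens i j : j = i.+1 :> nat -> weq (sub (twistR i j) gens) gens.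
Proof.
move=> ij; have [A [B [E hA hB]]] := enum_ord_split ij.
have ji : (i == j) = false by apply/eqP => /(congr1 val) /=; rewrite ij; lia.
have tw k : (k != i) && (k != j) -> twistR i j k = gen k.
  by rewrite /twistR => /andP[/negbTE-> /negbTE->].
rewrite /gens E !map_cat /= sub_cat !sub_cons !sub_gens_fixed; last 2 first.
- by move=> k /hB /tw.
- by move=> k /hA /tw.
apply: weq_catl; rewrite /img /= /twistR eqxx ji eqxx /=.
exact: (weq_cancel (j, false)).
Qed.

Lemma sub_twistLR i j k : i != j -> weq (sub (twistL i j) (twistR i j k)) (gen k).
Proof.
move=> ij; have ji : (j == i) = false by rewrite eq_sym (negbTE ij).
rewrite /twistR; have [->|kj] := eqVneq k j.
  rewrite /sub /img /= /twistL ji !eqxx /=.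
  apply: (weq_trans (weq_cancel (i, true) _)); apply: weq_cons.
  exact: (weq_cancel (i, true) [::]).
have [->|ki] := eqVneq k i; first by rewrite sub_of_gen /twistL ji eqxx.
by rewrite sub_of_gen /twistL (negbTE ki) (negbTE kj).
Qed.

Lemma sub_twistRL i j k : i != j -> weq (sub (twistR i j) (twistL i j k)) (gen k).
Proof.
move=> ij; have ji : (j == i) = false by rewrite eq_sym (negbTE ij).
rewrite /twistL; have [->|ki] := eqVneq k i.
  rewrite /sub /img /= /twistR (negbTE ij) !eqxx /=.
  apply: (weq_trans (weq_cancel (j, false) _)); apply: weq_cons.
  exact: (weq_cancel (j, false) [::]).
have [->|kj] := eqVneq k j; first by rewrite sub_of_gen /twistR (negbTE ij) eqxx.
by rewrite sub_of_gen /twistR (negbTE ki) (negbTE kj).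
Qed.

Definition swap_at (T : Type) i j (p q : T) (h : 'I_n -> T) k :=
  if k == i then p else if k == j then q else h k.

Lemma sum_swap_at i j (p q : word n) x : i != j ->
  size p + size q < size (x i) + size (x j) ->
  \sum_k size (swap_at i j p q x k) < \sum_k size (x k).
Proof.
move=> ij lt; have ji : (j == i) = false by rewrite eq_sym (negbTE ij).
have sumE h : \sum_k size (h k : word n) =
    size (h i) + (size (h j) + \sum_(k | (k != i) && (k != j)) size (h k)).
  by rewrite (bigD1 i) // (bigD1 j) //= eq_sym.
rewrite !sumE /swap_at ji !eqxx (eq_bigr (fun k => size (x k))).
  by rewrite !addnA ltn_add2r.
by move=> k /andP[/negbTE-> /negbTE->].
Qed.

Lemma sum_swap1 i (p : word n) x : size p < size (x i) ->
  \sum_k size (if k == i then p else x k) < \sum_k size (x k).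
Proof.
move=> lt; rewrite (bigD1 i) // [X in _ < X](bigD1 i) //= eqxx.
rewrite (eq_bigr (fun k => size (x k))) ?ltn_add2r //.
by move=> k /negbTE->.
Qed.

Lemma sorted_enum_ord : sorted (fun i j : 'I_n => j == i.+1 :> nat) (enum 'I_n).
Proof.
have : sorted (fun a b : nat => b == a.+1) (iota 0 n).
  by case: n => //= m; elim: m 0 => //= m IH a; rewrite eqxx IH.
by rewrite -val_enum_ord sorted_map.
Qed.

Definition conjugating f s x := forall k, weq (f k) (conjw (gen (s k)) (x k)).

(** The terminal case: a length count shows that [f] is the identity of the free group. *)
Lemma planar_nonabsorbing f s x w : conjugating f s x -> weq (sub f gens) gens ->
  (forall k, reduced (conjw (gen (s k)) (x k))) ->
  (forall i j, j = i.+1 :> nat -> nonabsorbing (s i, x i) (s j, x j)) ->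
  planar w -> planar (sub f w).
Proof.
move=> fsx ft rd na pw.
pose l := [seq (s k, x k) | k <- enum 'I_n].
have sl : sorted (@nonabsorbing n) l.
  by rewrite sorted_map; apply: sub_sorted sorted_enum_ord => i j /= /eqP/na.
have al : all (fun b => reduced (conjw (gen b.1) b.2)) l.
  by rewrite all_map; apply/allP => k _ /=.
have prod : weq (conj_product l) gens.
  apply: weq_trans ft; rewrite /gens /l.
  elim: (enum 'I_n) => //= k E IH; apply: weq_cat IH; exact/weq_sym/fsx.
have rtot : reduced gens.
  by rewrite /gens /reduced sorted_map; elim: (enum 'I_n) => //= a [|b E] //= ->; rewrite /linv xpair_eqE andbF.
suff fk k : weq (f k) (gen k).
  apply: planar_weq pw; apply: weq_sym.
  by have := eq_weq_sub w fk; rewrite sub_id.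
have szl : size l = n by rewrite size_map size_enum_ord.
(* The reduced product has [n] letters, all taken up by the surviving central ones; so the first
   conjugator is empty and the others equal it. *)
have x0 : all (fun b => b.2 == [::]) l.
  case lE: l al sl prod => [//|a l'] al sl.
  have [r [rE sz eqr]] := reduce_conj_product al sl.
  rewrite /weq rE (reduce_id rtot) => /(congr1 size).
  rewrite size_cat size_winv /= size_map size_enum_ord => h.
  have {}h : size a.2 + (size r).+1 = n := h.
  have {}sz : size l' <= size r := sz.
  have szl' : (size l').+1 = n by move: szl; rewrite lE.
  have a0 : a.2 = [::] by apply: size0nil; move: h sz szl'; clear; lia.
  by rewrite /= a0 eqxx -a0; apply: eqr; move: (h) sz szl'; clear; lia.
have xk k0 : x k0 = [::].
  by apply/eqP; apply: (allP x0 (s k0, x k0)); apply: map_f; rewrite mem_enum.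
(* With empty conjugators the product is a positive word, hence already reduced, and can be compared
   letter by letter. *)
have sE : [seq (s k, false) | k <- enum 'I_n] = gens.
  rewrite -[RHS](reduce_id rtot) -prod -[LHS]reduce_id.
    congr reduce; rewrite /l; elim: (enum 'I_n) => //= a E ->.
    by rewrite /conj_product /= xk.
  rewrite /reduced sorted_map; elim: (enum 'I_n) => //= a [|b E] //= ->.
  by rewrite /linv xpair_eqE andbF.
have sk : s k = k.
  by have /eq_in_map/(_ k (mem_enum _ _)) [] := sE.
by apply: (weq_trans (fsx k)); rewrite xk sk.
Qed.

End Descent.

(** * The inductive step of the descent *)

Section Generation.
Variable n : nat.
Implicit Types (f x : 'I_n -> word n) (s : 'I_n -> 'I_n) (w : word n) (i j k : 'I_n).

Lemma shrink_conjugator k (u : word n) : ~~ reduced (conjw (gen k) u) ->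
  exists2 v, size v < size u & weq (conjw (gen k) v) (conjw (gen k) u).
Proof.
case: (boolP (reduced u)) => [ru|/size_reduceP lt _]; last first.
  by exists (reduce u) => //; apply: weq_conjw; apply: weq_reduce.
case: u ru => [|[g b] v] // rv nr.
have [gk|gk] := eqVneq g k; last first.
  case/negP: nr; rewrite /conjw reduced_cat reduced_winv rv winv_cons -cats1 /=.
  rewrite [path _ _ _]rv andbT /linv /= !xpair_eqE (negbTE gk) /=.
  by case: (winv v) => [|a v'] /=; rewrite ?last_cat /= negbK ?xpair_eqE (eq_sym k) (negbTE gk).
exists v => //; rewrite gk /conjw winv_cons -cats1 -catA; apply: weq_sym; apply: weq_catl => /=.
by case: b {rv nr}; [apply: weq_cons; apply: (weq_cancel (k, false)) | apply: (weq_cancel (k, true))].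
Qed.

Lemma conjw_conjw (u v : word n) y z :
  weq (conjw u y ++ conjw v z ++ winv (conjw u y)) (conjw v (z ++ winv (conjw u y))).
Proof. by rewrite /conjw !winv_cat !winvK -!catA. Qed.

Lemma conjwV_conjw (u v : word n) y z :
  weq (winv (conjw u y) ++ conjw v z ++ conjw u y) (conjw v (z ++ conjw u y)).
Proof. by rewrite /conjw !winv_cat !winvK -!catA. Qed.

(** The induction on the total length of the conjugators is general in [f], [s], [x] and [w],
    because a twist changes all four. *)
Lemma planar_conjugating f s x w : conjugating f s x -> weq (sub f (gens n)) (gens n) ->
  planar w -> planar (sub f w).
Proof.
have [N] := ubnP (\sum_k size (x k)); elim: N f s x w => // N IH f s x w lt fsx ft pw.
case: (pickP (fun k => ~~ reduced (conjw (gen (s k)) (x k)))) => [k|rd].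
  case/shrink_conjugator=> v sv vE; apply: (IH f s (fun l => if l == k then v else x l)) => //.
    by apply: leq_trans (sum_swap1 sv) _.
  by move=> l; case: eqP => [->|_] //; apply: weq_trans (fsx k) (weq_sym vE).
case: (pickP (fun p : 'I_n * 'I_n => (p.2 == p.1.+1 :> nat) &&
         ~~ nonabsorbing (s p.1, x p.1) (s p.2, x p.2))) => [[i j]|na] /=; last first.
  apply: planar_nonabsorbing fsx ft _ _ pw => [k|i j ij]; first by have := rd k => /= /negbFE.
  by have /= := na (i, j); rewrite ij eqxx => /negbFE.
case/andP=> /eqP ij; have nij : i != j by apply/eqP => /(congr1 val) /=; rewrite ij; lia.
have ji : (j == i) = false by rewrite eq_sym (negbTE nij).
(* With [tw'] inverse to [tw], first applying [tw'] to [w] and then [f'], which is [tw] followed by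
   [f], gives the same element as [f]. *)
have rec tw tw' i' j' p q :
    weq (sub tw (gens n)) (gens n) -> (forall k, weq (sub tw (tw' k)) (gen k)) ->
    (forall k, k != i -> k != j -> tw k = gen k) -> planar (sub tw' w) ->
    weq (sub f (tw i)) (conjw (gen i') p) -> weq (sub f (tw j)) (conjw (gen j') q) ->
    size p + size q < size (x i) + size (x j) -> planar (sub f w).
  move=> tt inv fix_ pw' hi hj sz; pose f' k := sub f (tw k).
  have : planar (sub f' (sub tw' w)).
    apply: (IH f' (swap_at i j i' j' s) (swap_at i j p q x)) => //.
    - exact: leq_trans (sum_swap_at nij sz) lt.
    - move=> k; rewrite /f' /swap_at; case: eqP => [->//|/eqP ki]; case: eqP => [->//|/eqP kj].
      by rewrite fix_ // sub_of_gen; apply: fsx.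
    - by rewrite /f' -sub_sub; apply: weq_trans (weq_sub f tt) ft.
  apply: planar_weq; rewrite /f' -sub_sub; apply: weq_sub; rewrite sub_sub.
  by have := eq_weq_sub w inv; rewrite sub_id.
rewrite negb_and !negbK /= => /orP[] /suffixP[y yE].
(* Here $x_j = y\, t_{s(i)} x_i$, and conjugating by the inverse of $f(t_i)$ turns $x_j$ into $y
   x_i$, one letter shorter. *)
- apply: (rec (twistL i j) (twistR i j) (s j) (s i) (y ++ x i) (x i)).
  + exact: sub_twistL_gens.
  + by move=> k; apply: sub_twistLR.
  + by move=> k ki kj; rewrite /twistL (negbTE ki) (negbTE kj).
  + exact: planar_twistR.
  + rewrite /twistL eqxx /sub /= cats0 /img /=.
    apply: (weq_trans (v := conjw (gen (s i)) (x i) ++ conjw (gen (s j)) (x j) ++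
                             winv (conjw (gen (s i)) (x i)))).
      by apply: weq_cat; [|apply: weq_cat; [|apply: weq_winv]]; apply: fsx.
    apply: (weq_trans (conjw_conjw _ _ _ _)); apply: weq_conjw.
    rewrite yE /conjw !winv_cat winvK -!catA.
    have := weq_mid (y ++ gen (s i)) (x i) (winv (gen (s i)) ++ x i).
    rewrite -!catA => h; apply: (weq_trans h); exact: weq_mid.
  + by rewrite /twistL ji eqxx sub_of_gen; apply: fsx.
  + by rewrite yE !size_cat /=; lia.
(* Here $x_i = y\, t_{s(j)}^{-1} x_j$, and conjugating by $f(t_j)$ turns $x_i$ into $y x_j$. *)
- apply: (rec (twistR i j) (twistL i j) (s j) (s i) (x j) (y ++ x j)).
  + exact: sub_twistR_gens.
  + by move=> k; apply: sub_twistRL.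
  + by move=> k ki kj; rewrite /twistR (negbTE ki) (negbTE kj).
  + exact: planar_twistL.
  + by rewrite /twistR (negbTE nij) eqxx sub_of_gen; apply: fsx.
  + rewrite /twistR eqxx /sub /= cats0 /img /=.
    apply: (weq_trans (v := winv (conjw (gen (s j)) (x j)) ++ conjw (gen (s i)) (x i) ++
                             conjw (gen (s j)) (x j))).
      by apply: weq_cat; [apply: weq_winv|apply: weq_cat]; apply: fsx.
    apply: (weq_trans (conjwV_conjw _ _ _ _)); apply: weq_conjw.
    rewrite yE /conjw -!catA.
    have := weq_mid (y ++ [:: (s j, true)]) (x j) (gen (s j) ++ x j).
    rewrite -!catA => h; apply: (weq_trans h).
    exact: (weq_mid y [:: (s j, true)]).
  + by rewrite yE !size_cat /=; lia.
Qed.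

End Generation.

Theorem theoremA (n : nat) :
  (forall (w : word n) (f : 'I_n -> word n),
      reduced w -> in_Bn f -> planar w -> planar (wact f w)) /\
  (forall (hn : (0 < n)%N) (f : 'I_n -> word n),
      in_Bn f -> planar (wact f (gen (Ordinal hn)))).
Proof.
have main (w : word n) (f : 'I_n -> word n) : in_Bn f -> planar w -> planar (wact f w).
  case=> _ fz [s fs] pw.
  have [x xE] := fin_all_exists fs.
  apply: (@planar_weq _ (sub f w)); first exact/weq_sym/weq_reduce.
  (* [conjugate] puts the conjugator on the left and [conjw] puts its inverse there, hence
     [winv]. *)
  apply: (@planar_conjugating _ f s (fun k => winv (x k))) pw.
    move=> k; rewrite /conjw winvK /weq -(xE k).
    by rewrite /wact -/(sub f (gen k)) sub_of_gen.
  (* Since [z1] is the inverse of the product of the generators, fixing one amounts to fixing the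
     other. *)
  have : weq (sub f (z1 n)) (z1 n) by rewrite /weq -[in RHS]fz [RHS]weq_reduce.
  by rewrite sub_winv => /weq_winv; rewrite !winvK.
split; first by move=> w f _; apply: main.
by move=> hn f fB; apply: main => //; apply: planar_gen.
Qed.
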